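(* Let $\mathbb F$ be a field of characteristic different from $2$ and $3$, and let $(A,\bar{\ },*,\{\ldots\})$ be a dicyclic ternary algebra over $\mathbb F$, with $A_0=\{x\in A:\bar x=x\}$ and $A_1=\{x\in A:\bar x=-x\}$. Assume $A$ contains an element $e\in A_0$ such that $\{e,e,a\}=-2a$ for any $a\in A_0$, and $\{e,e,x\}=x$ and $\{x,e,e\}=0$ for any $x\in A_1$. Then the pair $(A_0,A_1)$ is a $J$-ternary algebra with operations $$a\cdot b=-\tfrac12\{a,e,b\},\qquad a\bullet x=\{a,e,x\},$$ $$\langle x|y\rangle=-\tfrac12(e*x)*(e*y),\qquad (x,y,z)=-\tfrac12\{x,e*y,z\},$$ for any $a,b\in A_0$ and $x,y,z\in A_1$.
   Context: Dicyclic ternary algebras. A dicyclic ternary algebra $(A,\bar{\ },*,\{\ldots\})$ is a vector space with a linear map $x\mapsto\bar x$, a bilinear anticommutative product $x*y$ and a trilinear product $\{x,y,z\}$ such that $\bar{\bar x}=x$, $\overline{x*y}=\bar x*\bar y$, $\overline{\{x,y,z\}}=\{\bar x,\bar y,\bar z\}$ and, for all elements: (D1) $\{x,z,y\}-\{y,z,x\}=(\bar x*\bar y)*\bar z$; (D2) $\{u,\bar v,x*y\}+\{v,u,x\}*y+x*\{v,u,y\}=0$; (D3) $\{x,y*z,w\}+\{y,z*x,w\}+\{z,x*y,w\}=0$; (D4) $\{\bar x*\bar y,z,w\}+\{\bar y*\bar z,x,w\}+\{\bar z*\bar x,y,w\}=0$; (D5) $\{u,v,\{x,y,z\}\}=\{\{u,v,x\},y,z\}-\{x,\{v,\bar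 u,y\},z\}+\{x,y,\{u,v,z\}\}$. $J$-ternary algebras. A special unital Jordan module for a unital Jordan algebra $(J,\cdot)$ is a vector space $T$ with a bilinear map $(a,x)\mapsto a\bullet x$, with $1\bullet x=x$ and $(a\cdot b)\bullet x=\frac12(a\bullet(b\bullet x)+b\bullet(a\bullet x))$. Let $J$ be a unital Jordan algebra, $T$ a special unital Jordan module for $J$, $\langle\cdot|\cdot\rangle:T\times T\to J$ a skew symmetric bilinear map and $(\cdot,\cdot,\cdot):T^3\to T$ a trilinear product. $(J,T)$ is a $J$-ternary algebra if for all $a\in J$, $x,y,z,w,v\in T$: (JT1) $a\cdot\langle x|y\rangle=\frac12(\langle a\bullet x|y\rangle+\langle x|a\bullet y\rangle)$; (JT2) $a\bullet(x,y,z)=(a\bullet x,y,z)-(x,a\bullet y,z)+(x,y,a\bullet z)$; (JT3) $(x,y,z)=(z,y,x)-\langle x|z\rangle\bullet y$; (JT4) $(x,y,z)=(y,x,z)+\langle x|y\rangle\bullet z$; (JT5) $\langle(x,y,z)|w\rangle+\langle z|(x,y,w)\rangle=\langle x|\langle z|w\rangle\bullet y\rangle$; (JT6) $(x,y,(z,w,v))=((x,y,z),w,v)+(z,(y,x,w),v)+(z,w,(x,y,v))$. *)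

(* Defs.v *)
From HB Require Import structures.
From mathcomp Require Import all_boot all_order all_algebra.

Set Implicit Arguments.
Unset Strict Implicit.
Unset Printing Implicit Defensive.

Import GRing.Theory.
Local Open Scope ring_scope.

Section Algebras.
Variable F : fieldType.

Definition trilinear (U V W X : lmodType F) (t : U -> V -> W -> X) : Prop :=
  [/\ forall y z, linear (fun x => t x y z),
      forall x z, linear (fun y => t x y z)
    & forall x y, linear (fun z => t x y z)].

Record dicyclic_ternary_algebra (A : lmodType F) (bar : {linear A -> A})
    (mul : {bilinear A -> A -> A}) (tri : A -> A -> A -> A) : Prop := {
  dta_mul_anti : forall x y, mul x y = - mul y x;
  dta_tri_trilinear : trilinear tri;
  dta_barK : forall x, bar (bar x) = x;
  dta_bar_mul : forall x y, bar (mul x y) = mul (bar x) (bar y);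
  dta_bar_tri : forall x y z,
    bar (tri x y z) = tri (bar x) (bar y) (bar z);
  dta_D1 : forall x y z,
    tri x z y - tri y z x = mul (mul (bar x) (bar y)) (bar z);
  dta_D2 : forall u v x y,
    tri u (bar v) (mul x y) + mul (tri v u x) y + mul x (tri v u y) = 0;
  dta_D3 : forall x y z w,
    tri x (mul y z) w + tri y (mul z x) w + tri z (mul x y) w = 0;
  dta_D4 : forall x y z w,
    tri (mul (bar x) (bar y)) z w + tri (mul (bar y) (bar z)) x w
      + tri (mul (bar z) (bar x)) y w = 0;
  dta_D5 : forall u v x y z,
    tri u v (tri x y z) =
      tri (tri u v x) y z - tri x (tri v (bar u) y) z + tri x y (tri u v z)
}.

(* Linear Jordan algebras; 1 = 0 is not excluded, as in the zero algebra. *)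
Record unital_jordan_algebra (J : lmodType F) (dot : {bilinear J -> J -> J})
    (one : J) : Prop := {
  uja_comm : forall a b, dot a b = dot b a;
  uja_jordan : forall a b,
    dot (dot (dot a a) b) a = dot (dot a a) (dot b a);
  uja_one : forall a, dot one a = a
}.

Record special_unital_jordan_module (J T : lmodType F)
    (dot : {bilinear J -> J -> J}) (one : J) (act : {bilinear J -> T -> T}) :
    Prop := {
  sujm_one : forall x, act one x = x;
  sujm_dot : forall a b x,
    act (dot a b) x = 2^-1 *: (act a (act b x) + act b (act a x))
}.

Record J_ternary_algebra (J T : lmodType F)
    (dot : {bilinear J -> J -> J}) (act : {bilinear J -> T -> T})
    (br : {bilinear T -> T -> J}) (tri : T -> T -> T -> T) : Prop := {
  jta_unital : exists2 one : J,
    unital_jordan_algebra dot one & special_unital_jordan_module dot one act;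
  jta_br_skew : forall x y, br x y = - br y x;
  jta_tri_trilinear : trilinear tri;
  jta_JT1 : forall a x y,
    dot a (br x y) = 2^-1 *: (br (act a x) y + br x (act a y));
  jta_JT2 : forall a x y z,
    act a (tri x y z) = tri (act a x) y z - tri x (act a y) z
                          + tri x y (act a z);
  jta_JT3 : forall x y z, tri x y z = tri z y x - act (br x z) y;
  jta_JT4 : forall x y z, tri x y z = tri y x z + act (br x y) z;
  jta_JT5 : forall x y z w,
    br (tri x y z) w + br z (tri x y w) = br x (act (br z w) y);
  jta_JT6 : forall x y z w v,
    tri x y (tri z w v) =
      tri (tri x y z) w v + tri z (tri y x w) v + tri z w (tri x y v)
}.

Section Eigenparts.
Variables (A : lmodType F) (bar : {linear A -> A}).

Definition even_part : {pred A} := [pred x | bar x == x].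
Definition odd_part : {pred A} := [pred x | bar x == - x].

Fact even_part_submod_closed : submod_closed even_part.
Proof.
split=> [|a x y]; rewrite !inE ?linear0 // linearP.
by move=> /eqP-> /eqP->.
Qed.
HB.instance Definition _ :=
  GRing.isSubmodClosed.Build F A even_part even_part_submod_closed.

Fact odd_part_submod_closed : submod_closed odd_part.
Proof.
split=> [|a x y]; rewrite !inE ?linear0 ?oppr0 // linearP.
by move=> /eqP-> /eqP->; rewrite scalerN opprD.
Qed.
HB.instance Definition _ :=
  GRing.isSubmodClosed.Build F A odd_part odd_part_submod_closed.

Record even_space : predArgType :=
  Even { even_val :> A; _ : even_val \in even_part }.
HB.instance Definition _ := [isSub for even_val].
HB.instance Definition _ := [Choice of even_space by <:].
HB.instance Definition _ := [SubChoice_isSubZmodule of even_space by <:].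
HB.instance Definition _ := [SubZmodule_isSubLmodule of even_space by <:].

Record odd_space : predArgType :=
  Odd { odd_val :> A; _ : odd_val \in odd_part }.
HB.instance Definition _ := [isSub for odd_val].
HB.instance Definition _ := [Choice of odd_space by <:].
HB.instance Definition _ := [SubChoice_isSubZmodule of odd_space by <:].
HB.instance Definition _ := [SubZmodule_isSubLmodule of odd_space by <:].

End Eigenparts.

End Algebras.

(* Main.v *)
Require Import Defs.
From HB Require Import structures.
From mathcomp Require Import all_boot all_order all_algebra.
From mathcomp Require Import ring.

Set Implicit Arguments.
Unset Strict Implicit.
Unset Printing Implicit Defensive.

Import GRing.Theory.
Local Open Scope ring_scope.

(** Write [a, b, c] for even elements, [x, y, z] for odd ones, and
    [x' = e * x].

    Taking [u = v = e] in (D2) and (D5) shows that [{e, e, _}] acts by weights: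
    it is [-2] on the even part and [1] on the odd part, so a product whose
    weight is inconsistent is killed by a nonzero scalar and vanishes.  This
    gives [a * b = 0] ([mul_even_even]) and [{x, a, y} = 0].  The hypothesis
    [{x, e, e} = 0], read through (D1), says that [x |-> x'] is an involution
    of the odd part ([mul_e_mul_e]).  Together these reduce nearly all mixed
    triple products to the binary product:
      [{x, a, b} = {a, x, y} = 0],  [{a, b, x} = b * (a * x)],
      [{x, y, a} = - (a * x) * y].
    Of the triple products that occur in the identities, only [{a, b, c}] and
    [{x, y, z}] are left.  The axioms (D2) and (D3) then
    say how products with even elements act on these two, and each of
    (JT1)-(JT6), as well as the module identity, is one such relation rewritten
    with the involution.

    On the even part (D1) makes [{a, b, c}] symmetric in [a] and [c], and (D5)
    is then the identity of Jordan triple systems.  The product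
    [{a, e, b}] is a homotope of this triple system, so the Jordan identity is
    the classical fact that homotopes are Jordan algebras in the absence of
    3-torsion ([jts_homotope_jordan]). *)

(** * Linear equations in modules without 2- and 3-torsion *)

Section Torsion.
Variables (F : fieldType) (V : lmodType F).

Lemma mulrn_pchar_inj p (v : V) :
  prime p -> p \notin [pchar F] -> v *+ p = 0 -> v = 0.
Proof.
move=> p_pr; rewrite inE p_pr /= => p_neq0 /eqP.
by rewrite -scaler_nat scaler_eq0 (negPf p_neq0) => /eqP.
Qed.

(** In affine terms [q] is the midpoint of [p] and [r], and [p] that of [q] and
    [r]: then [p - q] is twice [q - p]. *)
Lemma midpoint_swap_eq (p q r : V) : 3%N \notin [pchar F] ->
  p + r = q + q -> q + r = p + p -> p = q.
Proof.
move=> char_neq3 prE qrE.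
apply/subr0_eq/(mulrn_pchar_inj _ char_neq3) => //.
apply/eqP; rewrite mulrnBl subr_eq0; apply/eqP.
by rewrite !mulrS !mulr0n !addr0 -qrE -prE addrCA.
Qed.

(** The form in which weight comparisons are used: [k] is the discrepancy
    between two ways of computing a weight. *)
Lemma scalerN6_eq0 (k : F) (v : V) :
    2%N \notin [pchar F] -> 3%N \notin [pchar F] ->
  k = - 6 -> k *: v = 0 -> v = 0.
Proof.
move=> char_neq2 char_neq3 -> /eqP.
rewrite scaleNr oppr_eq0 scaler_nat (mulrnA _ 2 3).
by move=> /eqP /mulrn_pchar_inj-/(_ isT char_neq3) /mulrn_pchar_inj->.
Qed.

(** Used when [S] and [S'] are the values at a vector of the two composites of
    a pair of operators: the hypotheses evaluate the two commutators
    [S - S'] and [S' - S], which are opposite. *)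
Lemma commutator_cancel (P P' Q R S S' : V) :
  S = P - R + S' -> S' = P' - Q + S -> P + P' = R + Q.
Proof.
move=> SE S'E; apply/subr0_eq; rewrite opprD addrACA.
by apply: (addIr S); rewrite add0r -[LHS]addrA -S'E -SE.
Qed.

End Torsion.

(** * Scalars in trilinear maps *)

Section Trilinear.
Variables (F : fieldType) (U V W X : lmodType F) (t : U -> V -> W -> X).
Hypothesis t_lin : trilinear t.

Lemma trilinear_ul y z : linear (fun x => t x y z). Proof. by case: t_lin. Qed.
Lemma trilinear_um x z : linear (fun y => t x y z). Proof. by case: t_lin. Qed.
Lemma trilinear_ur x y : linear (fun z => t x y z). Proof. by case: t_lin. Qed.

Lemma trilinear_Zl k x y z : t (k *: x) y z = k *: t x y z.
Proof. exact: (scalable_linear (trilinear_ul y z)). Qed.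
Lemma trilinear_Zm k x y z : t x (k *: y) z = k *: t x y z.
Proof. exact: (scalable_linear (trilinear_um x z)). Qed.
Lemma trilinear_Zr k x y z : t x y (k *: z) = k *: t x y z.
Proof. exact: (scalable_linear (trilinear_ur x y)). Qed.
Lemma trilinear_Nl x y z : t (- x) y z = - t x y z.
Proof. by rewrite -!scaleN1r trilinear_Zl. Qed.
Lemma trilinear_Nm x y z : t x (- y) z = - t x y z.
Proof. by rewrite -!scaleN1r trilinear_Zm. Qed.
Lemma trilinear_0r x y : t x y 0 = 0.
Proof. by rewrite -(scale0r 0) trilinear_Zr !scale0r. Qed.
Lemma trilinear_Nr x y z : t x y (- z) = - t x y z.
Proof. by rewrite -!scaleN1r trilinear_Zr. Qed.

End Trilinear.

(** * Jordan triple systems and their homotopes *)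

Section JordanTriple.
Variables (F : fieldType) (V : lmodType F) (t : V -> V -> V -> V).
Hypotheses (char_neq3 : 3%N \notin [pchar F]).
Hypothesis tC : forall x y z, t x y z = t z y x.
Hypothesis tD : forall u v x y z,
  t u v (t x y z) = t (t u v x) y z - t x (t v u y) z + t x y (t u v z).

(** Expanding either side by [tD] expresses it through the other one and the
    common term [{x, {y, x, z}, x}]; without 3-torsion the two then agree. *)
Lemma jts_outer_comm x y z : t x y (t x z x) = t x z (t x y x).
Proof.
apply: (@midpoint_swap_eq _ _ _ _ (t x (t y x z) x)) => //.
  by rewrite tD (tC (t x y x)) addrAC addrNK.
by rewrite tD (tC (t x z x)) addrAC (tC y x z) addrNK.
Qed.

Lemma jts_outer_inner x y z : t x (t y x z) x = t x y (t x z x).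
Proof.
have := tD x y x z x; rewrite (tC (t x y x)) -jts_outer_comm => /eqP.
by rewrite -subr_eq subrr eq_sym subr_eq0 => /eqP.
Qed.

(** With [D x y] the operator [{x, y, _}], this is
    [[D x y, D w y] + [D w y, D x y] = 0], both brackets being expanded by
    [tD].  It is the polarization in [x] of [D {x, y, x} y = D x {y, x, y}]. *)
Lemma jts_shift_outer x y w z :
  t (t x y w) y z + t (t x y w) y z = t x (t y w y) z + t w (t y x y) z.
Proof.
rewrite [RHS]addrC {2}(tC x y w).
exact: commutator_cancel (tD x y w y z) (tD w y x y z).
Qed.

(** The same for [[D x y, D x v] + [D x v, D x y] = 0], a polarization in the
    middle variable. *)
Lemma jts_shift_inner x y v z :
  t (t x y x) v z + t (t x v x) y z = t x (t y x v) z + t x (t y x v) z.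
Proof.
rewrite {2}(tC y x v).
exact: commutator_cancel (tD x y x v z) (tD x v x y z).
Qed.

(** The operators [D a u] and [D {a, u, a} u] commute.  Put
    [w = {a, u, a}], [v = {u, a, u}] and
    [X = D {a, u, w} u], [Y = D a {u, a, v}], [Z = D w v].  By [tD] their
    commutator is [X - Z], while the two shift lemmas read
    [X + X = Y + Z] and [Y + Y = X + Z], so that all three agree. *)
Lemma jts_homotope_jordan a u b :
  t a u (t (t a u a) u b) = t (t a u a) u (t a u b).
Proof.
set w := t a u a; set v := t u a u.
set X := t (t a u w) u b; set Z := t w v b.
have XYZ : X + X = t a (t u a v) b + Z.
  by rewrite jts_shift_outer -jts_outer_inner.
have XY : t a (t u a v) b = X.
  apply: (midpoint_swap_eq char_neq3 (esym XYZ)).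
  by rewrite addrC -jts_shift_inner jts_outer_inner.
have XZ : X = Z by apply: (addrI X); rewrite {1}XYZ XY.
by rewrite tD -/v -/X -/Z XZ subrr add0r.
Qed.

End JordanTriple.

(** * Triple products of homogeneous elements *)

Section Dicyclic.
Variables (F : fieldType) (A : lmodType F).
Variables (bar : {linear A -> A}) (mul : {bilinear A -> A -> A}).
Variable tri : A -> A -> A -> A.
Hypothesis char_neq2 : 2%N \notin [pchar F].
Hypothesis char_neq3 : 3%N \notin [pchar F].
Hypothesis dta : dicyclic_ternary_algebra bar mul tri.

Local Notation even := (even_part bar).
Local Notation odd := (odd_part bar).
Local Infix "**" := mul (at level 40, left associativity).

Let triL : trilinear tri. Proof. by case: dta. Qed.

Lemma bar_even a : a \in even -> bar a = a.
Proof. by move=> /eqP. Qed.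
Lemma bar_odd x : x \in odd -> bar x = - x.
Proof. by move=> /eqP. Qed.

Lemma mul_even_odd a x : a \in even -> x \in odd -> a ** x \in odd.
Proof.
move=> a0 x1; rewrite inE dta.(dta_bar_mul).
by rewrite (bar_even a0) (bar_odd x1) linearNr.
Qed.

Lemma mul_odd_odd x y : x \in odd -> y \in odd -> x ** y \in even.
Proof.
move=> x1 y1; rewrite inE dta.(dta_bar_mul).
by rewrite (bar_odd x1) (bar_odd y1) linearNl linearNr opprK.
Qed.

Lemma tri_even_even_even a b c :
  a \in even -> b \in even -> c \in even -> tri a b c \in even.
Proof. by move=> a0 b0 c0; rewrite inE dta.(dta_bar_tri) !bar_even. Qed.

Lemma tri_odd_odd_odd x y z :
  x \in odd -> y \in odd -> z \in odd -> tri x y z \in odd.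
Proof.
move=> x1 y1 z1; rewrite inE dta.(dta_bar_tri) !bar_odd //.
by rewrite (trilinear_Nl triL) (trilinear_Nm triL) (trilinear_Nr triL) opprK.
Qed.

Lemma tri_even_even_odd a b x :
  a \in even -> b \in even -> x \in odd -> tri a b x \in odd.
Proof.
move=> a0 b0 x1; rewrite inE dta.(dta_bar_tri) (bar_even a0) (bar_even b0).
by rewrite (bar_odd x1) (trilinear_Nr triL).
Qed.

Lemma tri_odd_even_odd x a y :
  x \in odd -> a \in even -> y \in odd -> tri x a y \in even.
Proof.
move=> x1 a0 y1; rewrite inE dta.(dta_bar_tri) (bar_even a0) !bar_odd //.
by rewrite (trilinear_Nl triL) (trilinear_Nr triL) opprK.
Qed.

Lemma tri_odd_even_even_odd x a b :
  x \in odd -> a \in even -> b \in even -> tri x a b \in odd.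
Proof.
move=> x1 a0 b0; rewrite inE dta.(dta_bar_tri) (bar_odd x1) !bar_even //.
by rewrite (trilinear_Nl triL).
Qed.

Variable e : A.
Hypothesis e0 : e \in even.
Hypothesis eea : forall a, a \in even -> tri e e a = (- 2) *: a.
Hypothesis eex : forall x, x \in odd -> tri e e x = x.
Hypothesis xee : forall x, x \in odd -> tri x e e = 0.

(** By (D2) the operator [{e, e, _}] is minus a derivation of the product; on
    [a * b] this compares the weights [-2] and [4]. *)
Lemma mul_even_even a b : a \in even -> b \in even -> a ** b = 0.
Proof.
move=> a0 b0; have ab0 : a ** b \in even.
  by rewrite inE dta.(dta_bar_mul) !bar_even.
have := dta.(dta_D2) e e a b.
rewrite (bar_even e0) !eea // linearZl_LR linearZr_LR /= -!scalerDl.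
by apply: scalerN6_eq0 => //; ring.
Qed.

Lemma tri_even_sym a z b : a \in even -> b \in even -> tri a z b = tri b z a.
Proof.
move=> a0 b0; apply/subr0_eq; rewrite dta.(dta_D1).
by rewrite (bar_even a0) (bar_even b0) (mul_even_even a0 b0) linear0l.
Qed.

(** By (D5) the operator [{e, e, _}] is a derivation of the triple product,
    up to a sign in the middle variable; here it compares the weights [-2] and
    [1 + 2 + 1]. *)
Lemma tri_odd_even_odd0 x a y :
  x \in odd -> a \in even -> y \in odd -> tri x a y = 0.
Proof.
move=> x1 a0 y1; have := dta.(dta_D5) e e x a y.
rewrite (bar_even e0) (eea (tri_odd_even_odd x1 a0 y1)) (eea a0).
rewrite (eex x1) (eex y1).
(* The outer weights [1] become scalars so that coefficients add up. *)
rewrite (trilinear_Zm triL) -{2 4}(scale1r (tri x a y)) -scalerBl -scalerDl.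
move=> /eqP; rewrite -subr_eq0 -scalerBl => /eqP.
by apply: scalerN6_eq0 => //; ring.
Qed.

(** The instance [{e, e, x} - {x, e, e} = - (e * x) * e] of (D1). *)
Lemma mul_e_mul_e x : x \in odd -> e ** (e ** x) = x.
Proof.
move=> x1; have := dta.(dta_D1) e x e.
rewrite (bar_even e0) (bar_odd x1) eex // xee // subr0.
by rewrite linearNr linearNl -dta.(dta_mul_anti).
Qed.

Lemma mul_e_eq0 x : x \in odd -> e ** x = 0 -> x = 0.
Proof. by move=> x1 ex0; rewrite -(mul_e_mul_e x1) ex0 linear0r. Qed.

(** Since [e * a = 0], (D2) gives [{x, a, e} * b = - e * {x, a, b}]; as
    multiplication by [e] is injective on the odd part it is enough to show
    [{x, a, e} = 0].  For [a = e] this is a hypothesis, which yields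
    [{x, e, b} = 0] and hence [{c, e, y} = e * (c * y)]; feeding the latter
    into (D2) determines [{e, c, y}], and (D1) compares it with
    [{y, c, e}]. *)
Lemma tri_odd_even_even0 x a b :
  x \in odd -> a \in even -> b \in even -> tri x a b = 0.
Proof.
have D2_even c d y : c \in even -> d \in even -> y \in odd ->
    tri y c e = 0 -> tri y c d = 0.
  move=> c0 d0 y1 yce0; apply: mul_e_eq0; first exact: tri_odd_even_even_odd.
  have := dta.(dta_D2) c y e d.
  by rewrite mul_even_even // (trilinear_0r triL) add0r yce0 linear0l add0r.
have L c y : c \in even -> y \in odd -> tri c e y = e ** (c ** y).
  move=> c0 y1; have := dta.(dta_D1) c y e.
  rewrite (D2_even e c y) ?xee // subr0 (bar_even c0) (bar_odd y1).
  by rewrite (bar_even e0) linearNr linearNl -dta.(dta_mul_anti).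
have R c y : c \in even -> y \in odd -> tri e c y = c ** (e ** y).
  move=> c0 y1; have ey1 := mul_even_odd e0 y1.
  have := dta.(dta_D2) e c e (e ** y).
  rewrite (bar_even c0) (mul_e_mul_e y1) (L _ _ c0 ey1).
  rewrite (mul_e_mul_e (mul_even_odd c0 ey1)).
  rewrite (tri_even_sym _ c0) // eea // linearZl_LR -addrA.
  rewrite -[X in _ + (_ + X)]scale1r -scalerDl.
  rewrite [_ + 1](_ : _ = - 1); last by ring.
  by rewrite scaleN1r => /eqP; rewrite subr_eq0 => /eqP.
move=> x1 a0 b0; apply: D2_even => //.
have := dta.(dta_D1) e x a.
rewrite R // (bar_even e0) (bar_odd x1) (bar_even a0) linearNr linearNl.
rewrite -dta.(dta_mul_anti) => /eqP.
by rewrite subr_eq addrC -subr_eq subrr eq_sym => /eqP.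
Qed.

Lemma tri_even_even_oddE a b x :
  a \in even -> b \in even -> x \in odd -> tri a b x = b ** (a ** x).
Proof.
move=> a0 b0 x1; have := dta.(dta_D1) a x b.
rewrite (tri_odd_even_even0 x1) // subr0 => ->.
rewrite (bar_even a0) (bar_odd x1) (bar_even b0) linearNr linearNl.
by rewrite -dta.(dta_mul_anti).
Qed.

(** In (D2) with the pair [(a, x)] applied to [e * (e * y)], both other terms
    contain a vanishing product [{x, a, e}] or [{x, a, e * y}]. *)
Lemma tri_even_odd_odd0 a x y :
  a \in even -> x \in odd -> y \in odd -> tri a x y = 0.
Proof.
move=> a0 x1 y1; have ey1 := mul_even_odd e0 y1.
have := dta.(dta_D2) a x e (e ** y).
rewrite mul_e_mul_e // (tri_odd_even_even0 x1) // (tri_odd_even_odd0 x1) //.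
rewrite linear0l linear0r !addr0 (bar_odd x1) (trilinear_Nm triL).
by move/eqP; rewrite oppr_eq0 => /eqP.
Qed.

Lemma tri_odd_odd_evenE x y a :
  x \in odd -> y \in odd -> a \in even -> tri x y a = - ((a ** x) ** y).
Proof.
move=> x1 y1 a0; have := dta.(dta_D1) x a y.
rewrite (tri_even_odd_odd0 a0 y1 x1) subr0 => ->.
rewrite (bar_odd x1) (bar_odd y1) (bar_even a0) linearNr !linearNl opprK.
by rewrite (dta.(dta_mul_anti) x) linearNl.
Qed.

Lemma mul_tri_even a b c x :
    a \in even -> b \in even -> c \in even -> x \in odd ->
  tri a b c ** x = - (a ** (b ** (c ** x)) + c ** (b ** (a ** x))).
Proof.
move=> a0 b0 c0 x1; have cx1 := mul_even_odd c0 x1.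
have := dta.(dta_D2) b a c x; rewrite (bar_even a0).
rewrite (tri_even_even_oddE b0 a0 cx1) (tri_even_even_oddE a0 b0 x1).
rewrite addrAC addrC => /eqP.
by rewrite addr_eq0 => /eqP.
Qed.

Lemma tri_even_even_mul_odd a b x y :
    a \in even -> b \in even -> x \in odd -> y \in odd ->
  tri a b (x ** y) = - ((a ** (b ** x)) ** y + x ** (a ** (b ** y))).
Proof.
move=> a0 b0 x1 y1; have := dta.(dta_D2) a b x y.
rewrite (bar_even b0) (tri_even_even_oddE b0 a0 x1).
rewrite (tri_even_even_oddE b0 a0 y1) -addrA => /eqP.
by rewrite addr_eq0 => /eqP.
Qed.

(** This is (D2) for the odd pair [(w, x)]; its term [{x, w, b}] is a binary
    product by [tri_odd_odd_evenE]. *)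
Lemma mul_tri_odd b x w z :
    b \in even -> x \in odd -> w \in odd -> z \in odd ->
  b ** tri x w z = tri w x (b ** z) + ((b ** x) ** w) ** z.
Proof.
move=> b0 x1 w1 z1; have := dta.(dta_D2) w x b z.
rewrite (bar_odd x1) (trilinear_Nm triL) (tri_odd_odd_evenE x1 w1 b0) linearNl.
by rewrite -opprD => /eqP; rewrite addrC subr_eq0 => /eqP.
Qed.

Lemma mul_mul_odd a x y w :
    a \in even -> x \in odd -> y \in odd -> w \in odd ->
  (x ** y) ** (a ** w) = tri x (a ** y) w - tri y (a ** x) w.
Proof.
move=> a0 x1 y1 w1; have := dta.(dta_D3) a x y w.
rewrite (tri_even_even_oddE a0 (mul_odd_odd x1 y1) w1).
rewrite (dta.(dta_mul_anti) y a).
rewrite (trilinear_Nm triL) addrAC => /eqP.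
by rewrite subr_eq0 => /eqP <-; rewrite addrK.
Qed.

Lemma tri_even_mul_odd_even a x y b :
    a \in even -> b \in even -> x \in odd -> y \in odd ->
  tri a (x ** y) b = - ((b ** x) ** (a ** y) + (a ** x) ** (b ** y)).
Proof.
move=> a0 b0 x1 y1; have [ax1 ay1] := (mul_even_odd a0 x1, mul_even_odd a0 y1).
have := dta.(dta_D3) a x y b.
rewrite (dta.(dta_mul_anti) y a) (trilinear_Nm triL).
rewrite (tri_odd_odd_evenE x1 ay1 b0) (tri_odd_odd_evenE y1 ax1 b0) opprK.
rewrite (dta.(dta_mul_anti) (b ** y)) opprK -addrA => /eqP.
by rewrite addr_eq0 => /eqP.
Qed.

(** Multiplication by [e] conjugates the actions of [x * y] and [x' * y'] on
    the odd part.  Indeed [{e, x * y, e} = - 2 (x' * y')] by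
    [tri_even_mul_odd_even], while [mul_tri_even] computes the action of the
    left-hand side as [- 2 e * ((x * y) * (e * _))]. *)
Lemma mul_e_mul_mul_odd x y w : x \in odd -> y \in odd -> w \in odd ->
  e ** (((e ** x) ** (e ** y)) ** w) = (x ** y) ** (e ** w).
Proof.
move=> x1 y1 w1; have xy0 := mul_odd_odd x1 y1.
have ew1 := mul_even_odd e0 w1.
have := mul_tri_even e0 xy0 e0 w1; rewrite tri_even_mul_odd_even //.
rewrite linearNl linearDl => /oppr_inj /(congr1 (mul e)).
rewrite !linearDr /= mul_e_mul_e ?mul_even_odd // => /eqP.
rewrite -subr_eq0 -!mulr2n -mulrnBl => /eqP /mulrn_pchar_inj.
by move=> /(_ isT char_neq2) /subr0_eq.
Qed.

(** * The J-ternary identities without their scalar factors *)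

Lemma act_eE a x : a \in even -> x \in odd -> tri a e x = e ** (a ** x).
Proof. by move=> a0 x1; rewrite (tri_even_even_oddE a0 e0 x1). Qed.

Lemma mul_e_act a x : a \in even -> x \in odd -> e ** tri a e x = a ** x.
Proof.
by move=> a0 x1; rewrite act_eE // mul_e_mul_e // mul_even_odd.
Qed.

Lemma act_jordan_product a b x : a \in even -> b \in even -> x \in odd ->
  tri (tri a e b) e x = - (tri a e (tri b e x) + tri b e (tri a e x)).
Proof.
move=> a0 b0 x1; rewrite act_eE ?tri_even_even_even // mul_tri_even //.
rewrite linearNr linearDr /=.
have [ax1 bx1] := (tri_even_even_odd a0 e0 x1, tri_even_even_odd b0 e0 x1).
by rewrite (act_eE a0 bx1) (act_eE b0 ax1) (act_eE a0 x1) (act_eE b0 x1).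
Qed.

Lemma JT1_unscaled a x y : a \in even -> x \in odd -> y \in odd ->
  tri a e ((e ** x) ** (e ** y)) =
    - ((e ** tri a e x) ** (e ** y) + (e ** x) ** (e ** tri a e y)).
Proof.
move=> a0 x1 y1; have [ex1 ey1] := (mul_even_odd e0 x1, mul_even_odd e0 y1).
rewrite (tri_even_even_mul_odd a0 e0 ex1 ey1) !mul_e_act //.
by rewrite (mul_e_mul_e x1) (mul_e_mul_e y1).
Qed.

Lemma JT2_unscaled a x y z :
    a \in even -> x \in odd -> y \in odd -> z \in odd ->
  tri a e (tri x (e ** y) z) = tri (tri a e x) (e ** y) z
    - tri x (e ** tri a e y) z + tri x (e ** y) (tri a e z).
Proof.
move=> a0 x1 y1 z1; rewrite dta.(dta_D5) (bar_even a0) (mul_e_act a0 y1).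
rewrite (tri_even_even_oddE e0 a0 (mul_even_odd e0 y1)).
by rewrite (mul_e_mul_e y1).
Qed.

Lemma JT3_unscaled x y z : x \in odd -> y \in odd -> z \in odd ->
  tri x (e ** y) z = tri z (e ** y) x - tri ((e ** x) ** (e ** z)) e y.
Proof.
move=> x1 y1 z1; have [ex1 ez1] := (mul_even_odd e0 x1, mul_even_odd e0 z1).
apply/eqP; rewrite addrC -subr_eq dta.(dta_D1) act_eE ?mul_odd_odd //.
rewrite mul_e_mul_mul_odd // (bar_odd x1) (bar_odd z1).
rewrite (bar_odd (mul_even_odd e0 y1)).
by rewrite linearNr !linearNl linearNr linearNl opprK.
Qed.

Lemma JT4_unscaled x y z : x \in odd -> y \in odd -> z \in odd ->
  tri x (e ** y) z = tri y (e ** x) z + tri ((e ** x) ** (e ** y)) e z.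
Proof.
move=> x1 y1 z1; have [ex1 ey1] := (mul_even_odd e0 x1, mul_even_odd e0 y1).
rewrite act_eE ?mul_odd_odd // mul_e_mul_mul_odd //.
by rewrite mul_mul_odd // addrC subrK.
Qed.

Lemma mul_e_tri_odd x y z : x \in odd -> y \in odd -> z \in odd ->
  e ** tri x (e ** y) z =
    tri (e ** y) x (e ** z) + ((e ** x) ** (e ** y)) ** z.
Proof. by move=> x1 y1 z1; rewrite mul_tri_odd // mul_even_odd. Qed.

(** The involution turns [{x, y', z}] into [{x', y, z'}].  Both sides differ
    from [{y', x, z'}] by a binary term, on the left by [mul_e_tri_odd] and on
    the right by [JT4_unscaled]; [mul_e_mul_mul_odd] identifies these terms. *)
Lemma mul_e_tri_odd_swap x y z : x \in odd -> y \in odd -> z \in odd ->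
  e ** tri x (e ** y) z = tri (e ** x) y (e ** z).
Proof.
move=> x1 y1 z1; have [ex1 ey1] := (mul_even_odd e0 x1, mul_even_odd e0 y1).
have ez1 := mul_even_odd e0 z1.
have := JT4_unscaled ex1 ey1 ez1.
rewrite (mul_e_mul_e x1) (mul_e_mul_e y1) => ->.
rewrite act_eE ?mul_odd_odd // -mul_e_mul_mul_odd //.
by rewrite mul_e_mul_e ?mul_even_odd ?mul_odd_odd // mul_e_tri_odd.
Qed.

(** Applying [mul_e_tri_odd] to both triple products leaves a part that (D2)
    contracts to [{x, y', z' * w'}], and a part in [x' * y'] that
    [tri_even_even_mul_odd] contracts to [- {x' * y', e, z' * w'}].  Both are
    triple products with the even element [z' * w'] at one end, known from
    [tri_odd_odd_evenE] and [tri_even_even_mul_odd]. *)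
Lemma JT5_unscaled x y z w :
    x \in odd -> y \in odd -> z \in odd -> w \in odd ->
  (e ** tri x (e ** y) z) ** (e ** w) + (e ** z) ** (e ** tri x (e ** y) w) =
    (e ** x) ** (e ** tri ((e ** z) ** (e ** w)) e y).
Proof.
move=> x1 y1 z1 w1; have [ex1 ey1] := (mul_even_odd e0 x1, mul_even_odd e0 y1).
have [ez1 ew1] := (mul_even_odd e0 z1, mul_even_odd e0 w1).
have [xy0 zw0] := (mul_odd_odd ex1 ey1, mul_odd_odd ez1 ew1).
have D2 : tri (e ** y) x (e ** z) ** (e ** w)
    + (e ** z) ** tri (e ** y) x (e ** w) = tri x (e ** y) (e ** z ** (e ** w)).
  apply/subr0_eq; rewrite addrC addrA -(trilinear_Nm triL) -(bar_odd ey1).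
  exact: dta.(dta_D2).
rewrite !mul_e_tri_odd // linearDl linearDr /= addrACA D2.
have := tri_even_even_mul_odd xy0 e0 ez1 ew1.
rewrite (mul_e_mul_e z1) (mul_e_mul_e w1) => /(congr1 -%R); rewrite opprK => <-.
rewrite (tri_odd_odd_evenE x1 ey1 zw0) (tri_even_sym _ xy0 zw0).
rewrite (tri_even_even_mul_odd zw0 e0 ex1 ey1) opprK.
rewrite (mul_e_mul_e x1) (mul_e_mul_e y1) addrA addNr add0r.
by rewrite mul_e_act.
Qed.

(** This is (D5), whose middle term [{y', x, w'}] is [e * {y, x', w}] by
    [mul_e_tri_odd_swap]. *)
Lemma JT6_unscaled x y z w v :
    x \in odd -> y \in odd -> z \in odd -> w \in odd -> v \in odd ->
  tri x (e ** y) (tri z (e ** w) v) = tri (tri x (e ** y) z) (e ** w) v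
    + tri z (e ** tri y (e ** x) w) v + tri z (e ** w) (tri x (e ** y) v).
Proof.
move=> x1 y1 z1 w1 v1; rewrite dta.(dta_D5) (bar_odd x1).
by rewrite (trilinear_Nm triL) (trilinear_Nm triL) opprK mul_e_tri_odd_swap.
Qed.

(** * The operations on the even and the odd part *)

Local Notation A0 := (even_space bar).
Local Notation A1 := (odd_space bar).

Definition unit_elt : A0 := Even e0.

Definition even_tri (a b c : A0) : A0 :=
  Even (tri_even_even_even (valP a) (valP b) (valP c)).

Definition jdot (a b : A0) : A0 := - 2^-1 *: even_tri a unit_elt b.

Definition jact (a : A0) (x : A1) : A1 :=
  Odd (tri_even_even_odd (valP a) e0 (valP x)).

Definition jbr (x y : A1) : A0 := - 2^-1 *:
  Even (mul_odd_odd (mul_even_odd e0 (valP x)) (mul_even_odd e0 (valP y))).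

Definition jtri (x y z : A1) : A1 := - 2^-1 *:
  Odd (tri_odd_odd_odd (valP x) (mul_even_odd e0 (valP y)) (valP z)).

Lemma scalerPC (h k : F) (u v : A) :
  h *: (k *: u + v) = k *: (h *: u) + h *: v.
Proof. by rewrite scalerDr !scalerA mulrC. Qed.

Lemma jdot_bilinear : bilinear_for *:%R *:%R jdot.
Proof.
split=> [b k a a' | a k b b']; apply: val_inj; rewrite /= -scalerPC.
  by rewrite (trilinear_ul triL).
by rewrite (trilinear_ur triL).
Qed.

Lemma jact_bilinear : bilinear_for *:%R *:%R jact.
Proof.
split=> [x k a a' | a k x x']; apply: val_inj; rewrite /=.
  by rewrite (trilinear_ul triL).
by rewrite (trilinear_ur triL).
Qed.

Lemma jbr_bilinear : bilinear_for *:%R *:%R jbr.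
Proof.
split=> [y k x x' | x k y y']; apply: val_inj; rewrite /= -scalerPC.
  by rewrite linearPr linearPl.
by rewrite !linearPr.
Qed.

Lemma jtri_trilinear : trilinear jtri.
Proof.
split=> [y z k x x' | x z k y y' | x y k z z'];
  apply: val_inj; rewrite /= -scalerPC.
- by rewrite (trilinear_ul triL).
- by rewrite linearPr (trilinear_um triL).
- by rewrite (trilinear_ur triL).
Qed.

HB.instance Definition _ :=
  bilinear_isBilinear.Build F A0 A0 A0 *:%R *:%R jdot jdot_bilinear.
HB.instance Definition _ :=
  bilinear_isBilinear.Build F A0 A1 A1 *:%R *:%R jact jact_bilinear.
HB.instance Definition _ :=
  bilinear_isBilinear.Build F A1 A1 A0 *:%R *:%R jbr jbr_bilinear.

Lemma jdot_unital_jordan : unital_jordan_algebra jdot unit_elt.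
Proof.
split=> [a b | a b | a]; apply: val_inj => /=.
- by rewrite (tri_even_sym _ (valP a) (valP b)).
- have tC (c d f : A0) : even_tri c d f = even_tri f d c.
    exact/val_inj/(tri_even_sym _ (valP c) (valP f)).
  have tD (u v c d f : A0) :
      even_tri u v (even_tri c d f) = even_tri (even_tri u v c) d f
        - even_tri c (even_tri v u d) f + even_tri c d (even_tri u v f).
    by apply: val_inj; rewrite /= dta.(dta_D5) (bar_even (valP u)).
  have J := jts_homotope_jordan char_neq3 tC tD a unit_elt b.
  rewrite tC (tC a unit_elt b) in J.
  rewrite !(trilinear_Zl triL) (trilinear_Zr triL) /=.
  by rewrite [tri _ e a](congr1 val J).
- by rewrite eea ?(valP a) // scalerA mulrNN mulVf ?scale1r.
Qed.

Lemma jact_special_unital :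
  special_unital_jordan_module jdot unit_elt jact.
Proof.
split=> [x | a b x]; apply: val_inj => /=; first by rewrite eex ?(valP x).
rewrite (trilinear_Zl triL).
rewrite act_jordan_product ?(valP a) ?(valP b) ?(valP x) //.
by rewrite scaleNr scalerN opprK.
Qed.

Lemma even_odd_J_ternary : J_ternary_algebra jdot jact jbr jtri.
Proof.
split; last 6 first.
- move=> a x y; apply: val_inj; rewrite /= (trilinear_Zr triL) -scalerDr.
  rewrite JT1_unscaled ?(valP a) ?(valP x) ?(valP y) //.
  by rewrite !scalerN -scaleNr opprK.
- move=> a x y z; apply: val_inj; rewrite /= (trilinear_Zr triL).
  rewrite JT2_unscaled ?(valP a) ?(valP x) ?(valP y) ?(valP z) //.
  by rewrite scalerDr scalerBr.
- move=> x y z; apply: val_inj; rewrite /= (trilinear_Zl triL) -scalerBr.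
  by rewrite -JT3_unscaled ?(valP x) ?(valP y) ?(valP z).
- move=> x y z; apply: val_inj; rewrite /= (trilinear_Zl triL) -scalerDr.
  by rewrite -JT4_unscaled ?(valP x) ?(valP y) ?(valP z).
- move=> x y z w; apply: val_inj; rewrite /= (trilinear_Zl triL).
  rewrite !linearZr_LR linearZl_LR /= -!scalerDr.
  by rewrite JT5_unscaled ?(valP x) ?(valP y) ?(valP z) ?(valP w).
- move=> x y z w v; apply: val_inj; rewrite /= !linearZr_LR /=.
  rewrite !(trilinear_Zr triL) (trilinear_Zl triL) (trilinear_Zm triL).
  rewrite -!scalerDr.
  by rewrite JT6_unscaled ?(valP x) ?(valP y) ?(valP z) ?(valP w) ?(valP v).
- exists unit_elt; [exact: jdot_unital_jordan | exact: jact_special_unital].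
- by move=> x y; apply: val_inj; rewrite /= dta.(dta_mul_anti) scalerN.
- exact: jtri_trilinear.
Qed.

End Dicyclic.

Theorem corollary6p7 (F : fieldType)
    (char_neq2 : 2%N \notin [pchar F]) (char_neq3 : 3%N \notin [pchar F])
    (A : lmodType F) (bar : {linear A -> A}) (mul : {bilinear A -> A -> A})
    (tri : A -> A -> A -> A)
    (A_dicyclic : dicyclic_ternary_algebra bar mul tri)
    (e : A) (e_even : e \in even_part bar)
    (eea : forall a, a \in even_part bar -> tri e e a = (- 2) *: a)
    (eex : forall x, x \in odd_part bar -> tri e e x = x)
    (xee : forall x, x \in odd_part bar -> tri x e e = 0) :
  let A0 := even_space bar in
  let A1 := odd_space bar in
  exists (dot : {bilinear A0 -> A0 -> A0}) (act : {bilinear A0 -> A1 -> A1})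
         (br : {bilinear A1 -> A1 -> A0}) (tri1 : A1 -> A1 -> A1 -> A1),
  [/\ forall a b : A0, dot a b = - 2^-1 *: tri a e b :> A,
      forall (a : A0) (x : A1), act a x = tri a e x :> A,
      forall x y : A1, br x y = - 2^-1 *: mul (mul e x) (mul e y) :> A,
      forall x y z : A1, tri1 x y z = - 2^-1 *: tri x (mul e y) z :> A
    & J_ternary_algebra dot act br tri1].
Proof.
move=> A0 A1.
exists (jdot A_dicyclic e_even), (jact A_dicyclic e_even).
exists (jbr A_dicyclic e_even), (jtri A_dicyclic e_even).
by split=> //; apply: even_odd_J_ternary.
Qed.
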